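(* Consider a parametrized MDP $(\mathcal{X},\mathcal{A},\ell,P^{\theta_*})$ with scalar parameter $\theta_*\in\Theta\subseteq\mathbb{R}$ drawn from a known prior $P_1$, which is weakly communicating, and for which the differential value function $h(\cdot,\theta)$ of the average-cost Bellman optimality equation satisfies $h(x,\theta)\in[0,H]$ for all $x\in\mathcal{X}$, $\theta\in\Theta$, for some constant $H>0$. Suppose: (i) (Lipschitz dynamics) there is a constant $C$ such that for every state $x$, action $a$ and $\theta,\theta'\in\Theta$, $\|P(\cdot\mid x,a,\theta)-P(\cdot\mid x,a,\theta')\|_1\le C|\theta-\theta'|$; (ii) (Concentrating posterior) letting $N_j$ denote one plus the number of time steps in the first $j$ episodes of DS-PSRL and $\widetilde\theta_j$ the parameter sampled from the posterior at the start of episode $j$, there is a constant $C'$ such that $\max_j \mathbb{E}\big[N_{j-1}|\theta_*-\widetilde\theta_j|^2\big]\le C'\log T$. Then the Bayes regret of the DS-PSRL algorithm satisfies $R_T=\widetilde O(C\sqrt{C'T})$, where $\widetilde O$ hides logarithmic factors.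
   Context: Setting: $\mathcal{X}$ is the state space and $\mathcal{A}$ the action space (possibly infinite or continuous), $\ell:\mathcal{X}\times\mathcal{A}\to\mathbb{R}$ a known loss, and $P(\cdot\mid x,a,\theta)$ a known mapping from parameters to transition kernels; the true parameter $\theta_*$ is unknown and distributed according to the prior. The DS-PSRL algorithm: set $L=1$; for $t=1,2,\dots$: if $t=L$, sample $\widetilde\theta_t$ from the current posterior $P_t$ of $\theta_*$ and set $L\leftarrow 2L$, otherwise set $\widetilde\theta_t=\widetilde\theta_{t-1}$; take the action $a_t=\pi^*(x_t,\widetilde\theta_t)$ given by an (exact) optimal average-cost policy for the MDP with parameter $\widetilde\theta_t$; observe $x_{t+1}\sim P(\cdot\mid x_t,a_t,\theta_* )$ and update the posterior with $(x_t,a_t,x_{t+1})$ to get $P_{t+1}$. An episode is a maximal interval of time steps during which the sampled parameter is unchanged. The Bayes regret is $R_T=\mathbb{E}\big[\sum_{t=1}^T(\ell(x_t,a_t)-J(\theta_* ))\big]$, where $J(\theta)$ is the optimal average loss of the MDP with parameter $\theta$ (independent of the initial state under weak communication), and the expectation is over the prior, the system and the algorithm's randomness. The differential value function $h(\cdot,\theta)$ satisfies $J(\theta)+h(x,\theta)=\min_{a}\{\ell(x,a)+\mathbb{E}_{y\sim P(\cdot\mid x,a,\theta)}[h(y,\theta)]\}$. *)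

(* Defs.v *)
From HB Require Import structures.
From mathcomp Require Import all_boot all_order all_algebra.
From mathcomp Require Import all_classical all_reals all_analysis.
From mathcomp Require Import measurable_realfun.
Set Implicit Arguments. Unset Strict Implicit. Unset Printing Implicit Defensive.
Import Order.TTheory GRing.Theory Num.Theory.
Local Open Scope classical_set_scope.
Local Open Scope ring_scope.

(** Episodes of DS-PSRL.  Time steps are t = 1, 2, 3, ...; a new parameter is
    sampled at t = 1, 2, 4, 8, ... (the times t with t = L in the algorithm),
    so episode j (j >= 1) is the set of times 2^(j-1) <= t < 2^j. *)
Definition is_sample_time (t : nat) : Prop := exists k : nat, t = (2 ^ k)%N.

Definition episode (t : nat) : nat := (trunc_log 2 t).+1.

Definition episode_start (j : nat) : nat := (2 ^ j.-1)%N.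

Definition Nep (T j : nat) : nat :=
  (count (fun t => (episode t <= j)%N) (iota 1 T)).+1.

Definition rv_events {dO dY} {Omega : measurableType dO} {Y : measurableType dY}
  (I : set nat) (f : nat -> Omega -> Y) : set (set Omega) :=
  [set E | exists s, I s /\ exists B : set Y, measurable B /\ E = f s @^-1` B].

Definition rv_events1 {dO dY} {Omega : measurableType dO} {Y : measurableType dY}
  (g : Omega -> Y) : set (set Omega) :=
  [set E | exists B : set Y, measurable B /\ E = g @^-1` B].

Definition L1dist {d} {R : realType} {X : measurableType d}
  (mu nu : probability X R) : \bar R :=
  ereal_sup [set r : \bar R | exists (n : nat) (B : 'I_n -> set X),
     (forall i, measurable (B i)) /\
     (forall i j, i != j -> B i `&` B j = set0) /\
     (forall x, exists i, B i x) /\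
     r = (\sum_(i < n) `| mu (B i) - nu (B i) |)%E].

Definition obs_sigma {dO dX dA} {Omega : measurableType dO}
  {X : measurableType dX} {A : measurableType dA}
  (x : nat -> Omega -> X) (a : nat -> Omega -> A) (t : nat) : set (set Omega) :=
  <<s rv_events [set s | (1 <= s <= t)%N] x `|`
      rv_events [set s | (1 <= s < t)%N] a >>.

Definition before_sample_sigma {dO dX} {R : realType} {Omega : measurableType dO}
  {X : measurableType dX} (thetas : Omega -> R) (x : nat -> Omega -> X)
  (thetat : nat -> Omega -> R) (t : nat) : set (set Omega) :=
  <<s rv_events1 thetas `|` rv_events [set s | (1 <= s <= t)%N] x `|`
      rv_events [set s | (1 <= s < t)%N] thetat >>.

(** sigma-algebra of everything that happened before the transition from
    x_t to x_(t+1): theta_*, x_1..x_t and theta~_1..theta~_t (hence a_1..a_t) *)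
Definition before_transition_sigma {dO dX} {R : realType} {Omega : measurableType dO}
  {X : measurableType dX} (thetas : Omega -> R) (x : nat -> Omega -> X)
  (thetat : nat -> Omega -> R) (t : nat) : set (set Omega) :=
  <<s rv_events1 thetas `|` rv_events [set s | (1 <= s <= t)%N] x `|`
      rv_events [set s | (1 <= s <= t)%N] thetat >>.

(* Main.v *)
Require Import Defs.
From HB Require Import structures.
From mathcomp Require Import all_boot all_order all_algebra.
From mathcomp Require Import all_classical all_reals all_analysis.
From mathcomp Require Import measurable_realfun.
From mathcomp Require Import lra.
Import Order.TTheory GRing.Theory Num.Theory.
Local Open Scope classical_set_scope.
Local Open Scope ring_scope.

(** Write [th] for the true parameter and [s_t] for the sampled one.  The
    Bellman equation at [s_t] writes the loss at time [t] as
    [J(s_t) + h(x_t, s_t) - E_Q h(., s_t)], where [Q] is the transition law of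
    the sampled model.  Three comparisons give the bound.
    (1) [s_t] and [th] have the same law, so [J(s_t) - J(th)] has expectation 0.
    (2) Replacing [Q] by the true transition law costs at most
    [H C |th - s_t|]; the second moment of this distance is at most
    [2 C' ln T / t], because [N_(j-1) >= t / 2] when [t] is in episode [j], and
    [\sum_(t <= T) t^(-1/2) <= 2 sqrt T].
    (3) The expectation of [h(., s_t)] under the true law is, on average,
    [h(x_(t+1), s_t)], and the remaining differences
    [h(x_t, s_t) - h(x_(t+1), s_t)] telescope inside each episode and contribute
    at most [H] for each of the O(ln T) episodes. *)

(** * Integration: monotonicity, kernels and conditional laws *)

(** Integrability is not assumed, since the loss along the trajectory need not be integrable. The
    positive and negative parts are compared separately. *)
Lemma ae_le_integral {d} {T : measurableType d} {R : realType}
    (mu : {measure set T -> \bar R}) (f g : T -> \bar R) :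
  measurable_fun setT f -> measurable_fun setT g ->
  {ae mu, forall w, (f w <= g w)%E} ->
  (\int[mu]_w f w <= \int[mu]_w g w)%E.
Proof.
move=> mf mg fg; rewrite integralE [leRHS]integralE leeB//.
- apply: ae_ge0_le_integral => //; [exact: measurable_funepos..|].
  apply: filterS fg => w fgw _.
  by rewrite !funeposE ge_max !le_max fgw lexx orbT.
- apply: ae_ge0_le_integral => //; [exact: measurable_funeneg..|].
  apply: filterS fg => w fgw _.
  by rewrite !funenegE ge_max !le_max lexx orbT leeN2 fgw.
Qed.

Section pker_of.
Context {d d'} {X : measurableType d} {Y : measurableType d'} {R : realType}.
Variable k : X -> {measure set Y -> \bar R}.

(** An alias of [k] that carries the two proofs in its term, so that the kernel instances below can
    be inferred from it. *)
Definition pker_of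
  (mk : forall U, measurable U -> measurable_fun setT (k ^~ U))
  (k1 : forall x, k x setT = 1%E) : X -> {measure set Y -> \bar R} := k.

Hypothesis mk : forall U, measurable U -> measurable_fun setT (k ^~ U).
Hypothesis k1 : forall x, k x setT = 1%E.

HB.instance Definition _ := isKernel.Build _ _ X Y R (pker_of mk k1) mk.

HB.instance Definition _ :=
  Kernel_isProbability.Build _ _ X Y R (pker_of mk k1) k1.

End pker_of.

Lemma measurable_integral_pker {dO dX dY} {Omega : measurableType dO}
    {X : measurableType dX} {Y : measurableType dY} {R : realType}
    (k : Omega -> probability X R) (z : Omega -> Y) (f : X * Y -> \bar R) :
  (forall B, measurable B -> measurable_fun setT (fun w => k w B)) ->
  measurable_fun setT z -> measurable_fun setT f -> (forall p, 0 <= f p)%E ->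
  measurable_fun setT (fun w => \int[k w]_y f (y, z w))%E.
Proof.
move=> mk mz mf f0.
pose k0 (w : Omega) : {measure set X -> \bar R} := k w.
pose K0 : R.-pker Omega ~> X :=
  @pker_of _ _ _ _ _ k0 mk (fun w => probability_setT (k w)).
apply: (@measurable_fun_integral_finite_kernel _ _ _ _ _
  (fun q : Omega * X => f (q.2, z q.1)) K0) => //.
apply: measurableT_comp => //.
by apply: measurable_fun_pair => //; exact: measurableT_comp.
Qed.

(* A conditional law of [x'] known only through events in [z] still integrates
   functions of the pair [(x', z)]: both sides are integrals against measures on
   the product that agree on rectangles. *)
Lemma integral_freezing {dO dX dY} {Omega : measurableType dO}
    {X : measurableType dX} {Y : measurableType dY} {R : realType}
    (Pr : probability Omega R) (k : Omega -> probability X R)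
    (x' : Omega -> X) (z : Omega -> Y) (f : X * Y -> \bar R) :
  (forall B, measurable B -> measurable_fun setT (fun w => k w B)) ->
  measurable_fun setT x' -> measurable_fun setT z ->
  (forall A B, measurable A -> measurable B ->
    Pr (z @^-1` B `&` x' @^-1` A) = \int[Pr]_(w in z @^-1` B) k w A)%E ->
  measurable_fun setT f -> (forall p, 0 <= f p)%E ->
  (\int[Pr]_w f (x' w, z w) = \int[Pr]_w \int[k w]_y f (y, z w))%E.
Proof.
move=> mk mx' mz kP mf f0.
have mj w : measurable_fun setT (fun y : X => (y, z w)).
  by apply: measurable_fun_pair => //; exact: measurable_cst.
have mx'z : measurable_fun setT (fun w => (x' w, z w)).
  exact: measurable_fun_pair.
(* Viewing [Pr] as a constant kernel from [unit] turns the mixture over [w] of the laws of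
   [(y, z w)], with [y] drawn from [k w], into a kernel composition, whose integrals are iterated
   integrals. *)
pose l0 (_ : unit) : {measure set Omega -> \bar R} := Pr.
pose k1 (p : unit * Omega) : {measure set (X * Y) -> \bar R} :=
  measure_function_pushforward__canonical__measure_function_Measure
    (k p.2) (mj p.2).
have mk1 U : measurable U -> measurable_fun setT (fun p => k1 p U).
  move=> mU.
  have mIU : measurable_fun setT (fun q : X * Y => (\1_U q)%:E : \bar R).
    exact/measurable_EFinP.
  have -> : (fun p => k1 p U) = (fun w => \int[k w]_y (\1_U (y, z w))%:E)%E \o
      (snd : unit * Omega -> Omega).
    apply/funext => p /=; rewrite /k1 /= /pushforward.
    rewrite -[X in k _ X]setIT -integral_indic//.
    by rewrite -[X in measurable X]setTI; exact: (mj p.2 measurableT).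
  apply: measurableT_comp => //.
  apply: (measurable_integral_pker k z (fun q => (\1_U q)%:E) mk mz mIU) => q.
  by rewrite lee_fin.
have ml U : measurable U -> measurable_fun setT (l0 ^~ U).
  by move=> _; exact: measurable_cst.
pose L0 : R.-pker unit ~> Omega :=
  @pker_of _ _ _ _ _ l0 ml (fun _ => probability_setT Pr).
pose K1 : R.-pker (unit * Omega)%type ~> (X * Y)%type :=
  @pker_of _ _ _ _ _ k1 mk1 (fun p => probability_setT (k p.2)).
have eqn S : measurable S ->
    pushforward Pr (fun w => (x' w, z w)) S = mkcomp L0 K1 tt S.
  pose G : set (set (X * Y)) :=
    [set C | exists A, measurable A /\ exists B, measurable B /\ C = A `*` B].
  move=> mS.
  pose m1 := measure_function_pushforward__canonical__measure_function_Measure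
     Pr mx'z.
  apply: (@measure_unique _ _ _ G (fun _ => setT) _ _ _ _ m1 (mkcomp L0 K1 tt)) => //.
  - rewrite measurable_prod_measurableType; congr (<<s _ >>).
    rewrite predeqE; split => [[A mA [B mB <-]]|[A [mA [B [mB ->]]]]].
      by exists A; split => //; exists B.
    by exists A => //; exists B.
  - move=> _ _ [X1 [mX1 [X2 [mX2 ->]]]] [Y1 [mY1 [Y2 [mY2 ->]]]].
    rewrite -setXI; exists (X1 `&` Y1); split; first exact: measurableI.
    by exists (X2 `&` Y2); split => //; exact: measurableI.
  - by move=> _; exists setT; split => //; exists setT; split => //; rewrite setXTT.
  - by rewrite bigcup_const.
  - move=> _ [A [mA [B [mB ->]]]].
    rewrite /m1 /= /pushforward /mkcomp /= /kcomp /= /l0.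
    rewrite (_ : _ @^-1` _ = z @^-1` B `&` x' @^-1` A); last first.
      by apply/seteqP; split => w /= [].
    rewrite kP// integral_mkcond; apply: eq_integral => w _.
    rewrite /k1 /= /pushforward patchE; case: ifPn => [|] wB.
      congr (k w _); apply/seteqP; split => y //=; last by case.
      by split => //; rewrite inE in wB.
    rewrite (_ : _ @^-1` _ = set0) ?measure0//.
    apply/seteqP; split => y //= [_]; by rewrite notin_setE in wB.
  - by move=> _; rewrite /m1 /= /pushforward preimage_setT probability_setT ltry.
transitivity (\int[pushforward Pr (fun w => (x' w, z w))]_p f p)%E.
  by rewrite ge0_integral_pushforward// preimage_setT.
rewrite (@eq_measure_integral _ _ _ _ (mkcomp L0 K1 tt)); last first.
  by move=> S mS _; exact: eqn.
rewrite integral_kcomp//; apply: eq_integral => w _.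
by rewrite /K1 /= /k1 ge0_integral_pushforward// preimage_setT.
Qed.

(** * Comparing integrals under nearby or equal laws *)

(** The partition into [B] and its complement competes in the supremum, and its first term alone
    gives the bound. *)
Lemma L1dist_setD_le {d} {R : realType} {X : measurableType d}
    (mu nu : probability X R) (D : R) (B : set X) : measurable B ->
  (L1dist mu nu <= D%:E)%E -> (mu B <= nu B + D%:E)%E.
Proof.
move=> mB muD.
suff h : (`|mu B - nu B| <= D%:E)%E.
  rewrite -leeBlDl ?fin_num_measure//; last exact: (le_trans (lee_abs _)) h.
apply: le_trans muD; apply: (@le_trans _ _
  (\sum_(i < 2) `|mu (if i == ord0 then B else ~` B) -
                  nu (if i == ord0 then B else ~` B)|)%E).
  by rewrite big_ord_recl/= leeDl// big_ord1 abse_ge0.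
apply: ereal_sup_ubound; exists 2, (fun i => if i == ord0 then B else ~` B).
split; first by move=> i; case: ifP => // _; exact: measurableC.
split.
  move=> [[|[|//]] ?] [[|[|//]] ?] //= _; rewrite ?setICr ?setICl //.
split => // y; have [By|By] := pselect (B y).
  by exists ord0.
by exists (Ordinal (isT : (1 < 2)%N)).
Qed.

(* Layer cake: [\int f dmu] is the integral over [0, H] of [mu (f > r)]. *)
Lemma le_integral_L1dist {d} {R : realType} {X : measurableType d}
    (mu nu : probability X R) (D H : R) (f : X -> R) :
  measurable_fun setT f -> (forall y, 0 <= f y <= H) ->
  (L1dist mu nu <= D%:E)%E ->
  (\int[mu]_y (f y)%:E <= \int[nu]_y (f y)%:E + (H * D)%:E)%E.
Proof.
move=> mf f0H muD.
have H0 : 0 <= H by case/andP: (f0H point) => /le_trans; apply.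
have D0 : 0 <= D.
  have := @L1dist_setD_le _ _ _ mu nu D setT measurableT muD.
  by rewrite !probability_setT -EFinD lee_fin; lra.
pose f' : {mfun X >-> R} := HB.pack f (isMeasurableFun.Build _ _ _ _ f mf).
have ccdfE (P : probability X R) : (\int[P]_y (f y)%:E =
    \int[@lebesgue_measure R]_(r in `[0%R, H]) ccdf (P := P) f' r)%E.
  rewrite -(@expectation_def _ _ _ _ f') ge0_expectation_ccdf; last first.
    by move=> y; case/andP: (f0H y).
  rewrite [LHS]integral_mkcond [RHS]integral_mkcond.
  apply: eq_integral => r _; rewrite !patchE.
  rewrite !mem_setE !in_itv/= andbT; case: (leP 0 r) => //= r0.
  case: leP => // Hr; rewrite /ccdf /distribution /= /pushforward.
  rewrite (_ : _ @^-1` _ = set0) ?measure0//.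
  apply/seteqP; split => y //=; rewrite in_itv/= andbT => rf.
  by case/andP: (f0H y) => _; rewrite leNgt (lt_trans Hr rf).
rewrite !ccdfE.
have mcc (P : probability X R) :
   measurable_fun (`[0%R, H] : set (measurableTypeR R)) (ccdf (P := P) f').
  exact: measurable_funTS (ccdf_measurable _).
have -> : (H * D)%:E = (\int[@lebesgue_measure R]_(r in `[0%R, H]) D%:E)%E.
  rewrite integral_cst//= lebesgue_measure_itv/= lte_fin.
  case: ltP => H0'; first by rewrite -EFinD subr0 -EFinM mulrC.
  have -> : H = 0 by apply/le_anti/andP.
  by rewrite mul0r mule0.
rewrite -ge0_integralD//.
apply: ge0_le_integral => //.
- by apply: emeasurable_funD => //; exact: measurable_cst.
- move=> r _.
  have mB : measurable (f @^-1` `]r, +oo[).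
    by rewrite -[X in measurable X]setTI; exact: (mf measurableT).
  exact: L1dist_setD_le mB muD.
Qed.

(** Both sides are integrals of [f] against the common law. Integrability is transferred too,
    because for [J] it is assumed only at the true parameter. *)
Lemma integral_eq_distribution {d} {T : measurableType d} {R : realType}
    (Pr : probability T R) (phi psi : T -> R) (f : R -> R) :
  measurable_fun setT phi -> measurable_fun setT psi -> measurable_fun setT f ->
  (forall B, measurable B -> Pr (phi @^-1` B) = Pr (psi @^-1` B)) ->
  Pr.-integrable setT (fun w => (f (phi w))%:E) ->
  Pr.-integrable setT (fun w => (f (psi w))%:E) /\
  (\int[Pr]_w (f (phi w))%:E = \int[Pr]_w (f (psi w))%:E)%E.
Proof.
move=> mphi mpsi mf lawE iphi.
have mEf : measurable_fun setT (EFin \o f) by exact/measurable_EFinP.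
have ipsi : Pr.-integrable setT (fun w => (f (psi w))%:E).
  apply/integrableP; split.
    by apply/measurable_EFinP; exact: measurableT_comp.
  move/integrableP : iphi => [_]; apply: le_lt_trans.
  have mabs : measurable_fun setT (fun r => `|(f r)%:E|%E).
    exact: measurableT_comp.
  rewrite -[leLHS](@ge0_integral_pushforward _ _ _ _ _ _ mpsi Pr setT
     (fun r => `|(f r)%:E|%E))//.
  rewrite -[leRHS](@ge0_integral_pushforward _ _ _ _ _ _ mphi Pr setT
     (fun r => `|(f r)%:E|%E))//.
  rewrite le_eqVlt; apply/orP; left; apply/eqP.
  by apply: eq_measure_integral => A mA _ /=; rewrite /pushforward lawE.
split => //.
rewrite -[LHS](@integral_pushforward _ _ _ _ _ _ mphi Pr setT (EFin \o f))//.
rewrite -[RHS](@integral_pushforward _ _ _ _ _ _ mpsi Pr setT (EFin \o f))//.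
by apply: eq_measure_integral => A mA _ /=; rewrite /pushforward lawE.
Qed.

(** * Dyadic episodes and sums over them *)

Lemma is_sample_timeP (t : nat) : (0 < t)%N ->
  is_sample_time t <-> t = (2 ^ trunc_log 2 t)%N.
Proof.
move=> t0; split=> [[k ->]|->]; first by rewrite trunc_expnK.
by exists (trunc_log 2 t).
Qed.

Lemma trunc_log2_sample (t : nat) : (0 < t)%N -> is_sample_time t.+1 ->
  (trunc_log 2 t < trunc_log 2 t.+1)%N.
Proof.
move=> t0 /is_sample_timeP-/(_ isT) tE.
rewrite -(ltn_exp2l _ _ (isT : 1 < 2)%N) -tE ltnS.
by case/andP: (trunc_log_bounds (isT : 1 < 2)%N t0).
Qed.

Lemma trunc_log2_nonsample (t : nat) : (0 < t)%N -> ~ is_sample_time t.+1 ->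
  trunc_log 2 t.+1 = trunc_log 2 t.
Proof.
move=> t0 nt; apply/esym/trunc_log_eq => //.
have /andP[tl tu] := trunc_log_bounds (isT : 1 < 2)%N (isT : 0 < t.+1)%N.
rewrite (ltn_trans _ tu)// andbT -ltnS ltn_neqAle tl andbT.
by apply/eqP => tE; apply: nt; exists (trunc_log 2 t.+1).
Qed.

Lemma constant_on_episode (Y : Type) (f : nat -> Y) (t : nat) :
  (forall s, (2 <= s)%N -> ~ is_sample_time s -> f s = f s.-1) ->
  (0 < t)%N -> f t = f (episode_start (episode t)).
Proof.
move=> fE; rewrite /episode_start /episode /=.
elim: t => // -[_ _|t IH _]; first by rewrite trunc_log1.
have [st|nst] := pselect (is_sample_time t.+2).
  by congr f; apply/is_sample_timeP.
by rewrite fE//= IH// (trunc_log2_nonsample _ _ nst).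
Qed.

Lemma is_sample_time_episode_start (j : nat) : is_sample_time (episode_start j).
Proof. by exists j.-1. Qed.

(** With [k = trunc_log 2 t], the first [k] episodes are the times [1, ..., 2^k - 1], all at most
    [T]. Hence [Nep T k >= 2^k], while [t < 2^(k+1)]. *)
Lemma ltn_double_Nep (T t : nat) : (0 < t <= T)%N ->
  (t < (Nep T (episode t).-1).*2)%N.
Proof.
move=> /andP[t0 tT]; rewrite /episode /=; set k := trunc_log 2 t.
have /andP[kt tk] : (2 ^ k <= t < 2 ^ k.+1)%N by exact: trunc_log_bounds.
rewrite (leq_trans tk)// expnS mul2n leq_double /Nep.
have kT : ((2 ^ k).-1 <= T)%N.
  by rewrite (leq_trans (leq_pred _))// (leq_trans kt).
rewrite -(subnKC kT) iotaD count_cat -addSn (leq_trans _ (leq_addr _ _))//.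
rewrite -[X in (X <= _)%N]prednK ?expn_gt0// ltnS.
rewrite -[X in (X <= _)%N](size_iota 1); apply: eq_leq; apply/esym/eqP.
rewrite -all_count; apply/allP => s; rewrite mem_iota add1n prednK ?expn_gt0//.
move=> /andP[s0 sk]; rewrite /episode -(ltn_exp2l _ _ (isT : 1 < 2)%N).
by rewrite (leq_ltn_trans _ sk)//; case/andP: (trunc_log_bounds (isT : 1 < 2)%N s0).
Qed.

Lemma sum_invsqrt_le {R : realType} (T : nat) :
  \sum_(1 <= t < T.+1) (Num.sqrt t%:R)^-1 <= 2 * Num.sqrt T%:R :> R.
Proof.
elim: T => [|T IH]; first by rewrite big_geq// mulr_ge0// sqrtr_ge0.
rewrite big_nat_recr//=; apply: (le_trans (lerD IH (lexx _))).
have a0 := sqrtr_ge0 (T%:R : R).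
have b0 : 0 < Num.sqrt (T.+1%:R : R) by rewrite sqrtr_gt0.
have a2 := sqr_sqrtr (ler0n R T).
have b2 := sqr_sqrtr (ler0n R T.+1).
move: a0 b0 a2 b2; rewrite -natr1.
move: (Num.sqrt _) (Num.sqrt _) => a b a0 b0 a2 b2.
(* Multiplied by [b], the claim reads [2ab + 1 <= 2b^2]; as [b^2 = a^2 + 1], this is
   [(a - b)^2 >= 0]. *)
rewrite -(ler_pM2r b0) mulrDl mulVf ?gt_eqF//.
have := sqr_ge0 (a - b); nra.
Qed.

(** In [c t s], [t] is the time of the state and [s] that of the parameter. The term [- c T.+2 T.+1]
    is kept for the induction: it cancels the next [c T.+2 T.+2] when the parameter is kept, and
    otherwise the mismatch costs at most the [H] of the new episode. *)
Lemma episodewise_telescope {R : realType} (H : R) (c : nat -> nat -> R)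
    (T : nat) :
  (forall t s, 0 <= c t s <= H) ->
  (forall t, (2 <= t)%N -> ~ is_sample_time t -> c t t = c t t.-1) ->
  \sum_(1 <= t < T.+2) (c t t - c t.+1 t) <=
  H * (episode T.+1)%:R - c T.+2 T.+1.
Proof.
move=> cH cE; rewrite /episode.
have H0 : 0 <= H by case/andP: (cH 0 0); exact: le_trans.
elim: T => [|T IH].
  rewrite big_nat1 trunc_log1 mulr1 lerD2r.
  by case/andP: (cH 1 1).
rewrite big_nat_recr//=; apply: (le_trans (lerD IH (lexx _))).
have [st|nst] := pselect (is_sample_time T.+2).
  have /(ler_wpM2l H0) : ((trunc_log 2 T.+1).+2%:R <= (trunc_log 2 T.+2).+1%:R :> R).
    by rewrite ler_nat ltnS; exact: trunc_log2_sample.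
  rewrite -[_.+2%:R]natr1.
  case/andP: (cH T.+2 T.+1); case/andP: (cH T.+2 T.+2); nra.
by rewrite (trunc_log2_nonsample _ _ nst)// (cE T.+2)//= ; lra.
Qed.

(** [episode T] is one plus the integer part of [log_2 T], and the one is at most [log_2 T] since
    [T >= 2]. *)
Lemma episode_le_ln {R : realType} (T : nat) : (2 <= T)%N ->
  (episode T)%:R <= 2 / ln 2 * ln T%:R :> R.
Proof.
move=> T2; have l2 : 0 < ln 2 :> R by rewrite ln_gt0// ltr1n.
rewrite mulrAC ler_pdivlMr// /episode -natr1.
have /andP[kT _] := trunc_log_bounds (isT : 1 < 2)%N (ltnW T2).
have : (trunc_log 2 T)%:R * ln 2 <= ln T%:R :> R.
  rewrite mulr_natl -lnXn// -natrX ler_ln ?ler_nat ?posrE ?ltr0n ?expn_gt0//.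
  exact: ltnW.
have : ln 2 <= ln T%:R :> R by rewrite ler_ln ?ler_nat ?posrE ?ltr0n// ltnW.
lra.
Qed.

(** * First moment from second moment *)

(** With [m] the mean of [|f|], integrating [2m|f| <= f^2 + m^2] gives [m^2 <= M]; integrability
    comes from [|f| <= 1 + f^2]. *)
Lemma abs_le_sqrt_second_moment {d} {T : measurableType d} {R : realType}
    (Pr : probability T R) (f : T -> R) (M : R) :
  measurable_fun setT f -> (\int[Pr]_w (f w ^+ 2)%:E <= M%:E)%E ->
  Pr.-integrable setT (fun w => `|f w|%:E) /\
  (\int[Pr]_w `|f w|%:E <= (Num.sqrt M)%:E)%E.
Proof.
move=> mf fM.
have mf2 : measurable_fun setT (fun w => (f w ^+ 2)%:E).
  by apply/measurable_EFinP; exact: measurable_funX.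
have mfa : measurable_fun setT (fun w => `|f w|%:E).
  by apply/measurable_EFinP; exact: measurableT_comp.
have if2 : Pr.-integrable setT (fun w => (f w ^+ 2)%:E).
  apply/integrableP; split => //.
  under eq_integral do rewrite gee0_abs ?lee_fin ?sqr_ge0//.
  exact: le_lt_trans fM (ltry _).
have ic (r : R) : Pr.-integrable setT (fun _ => r%:E).
  by apply: finite_measure_integrable_cst.
have ifa : Pr.-integrable setT (fun w => `|f w|%:E).
  apply: (@le_integrable _ _ _ Pr setT _ _
    (fun w => 1%:E + (f w ^+ 2)%:E)%E) => //; last exact: integrableD.
  move=> w _; rewrite -EFinD !abse_EFin lee_fin normr_id.
  rewrite [leRHS]ger0_norm ?addr_ge0 ?sqr_ge0// -real_normK ?num_real//.
  have := normr_ge0 (f w); move: `|f w| => x; nra.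
split => //.
have fin := integrable_fin_num measurableT ifa.
have int0 : (0 <= \int[Pr]_w `|f w|%:E)%E.
  by apply: integral_ge0 => w _; rewrite lee_fin.
rewrite -(fineK fin) lee_fin; set m := fine _.
have m0 : 0 <= m by exact: fine_ge0.
suff mM : m ^+ 2 <= M.
  by rewrite -[m]ger0_norm// -sqrtr_sqr ler_wsqrtr.
have : (\int[Pr]_w ((2 * m)%:E * `|f w|%:E) <=
        \int[Pr]_w ((f w ^+ 2)%:E + (m ^+ 2)%:E))%E.
  apply: le_integral => //; [exact: integrableZl|exact: integrableD|].
  move=> w _; rewrite -EFinM -EFinD lee_fin -[f w ^+ 2]real_normK ?num_real//.
  have := sqr_ge0 (`|f w| - m); nra.
rewrite integralZl// integralD//= integral_cst//= probability_setT mule1.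
move=> /le_trans /(_ (leeD2r _ fM)).
rewrite -(fineK fin) -EFinM -EFinD lee_fin -/m.
nra.
Qed.

(** * The regret bound *)

Theorem theorem1 (R : realType) :
  exists K : R,
  forall (H C C' : R) (T : nat)
    (dO dX dA : measure_display) (Omega : measurableType dO)
    (X : measurableType dX) (A : measurableType dA)
    (Theta : set R)
    (ell : X -> A -> R) (P : X -> A -> R -> probability X R)
    (J : R -> R) (h : X -> R -> R) (pistar : X -> R -> A)
    (Pr : probability Omega R)
    (thetas : Omega -> R) (x : nat -> Omega -> X) (thetat : nat -> Omega -> R)
    (post : nat -> Omega -> probability R R),
  let a : nat -> Omega -> A := fun t w => pistar (x t w) (thetat t w) in
  (* ---- the parametrized MDP ---- *)
  0 < H -> 0 <= C -> (2 <= T)%N ->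
  measurable Theta ->
  measurable_fun setT (fun p : X * A => ell p.1 p.2) ->
  (forall B, measurable B ->
     measurable_fun setT (fun p : X * A * R => P p.1.1 p.1.2 p.2 B)) ->
  measurable_fun setT J ->
  measurable_fun setT (fun p : X * R => h p.1 p.2) ->
  measurable_fun setT (fun p : X * R => pistar p.1 p.2) ->
  (* h(., theta) takes values in [0, H] *)
  (forall th, Theta th -> forall x0, 0 <= h x0 th <= H) ->
  (* average-cost Bellman optimality equation, with pistar an optimal policy *)
  (forall th, Theta th -> forall x0,
     ((J th + h x0 th)%:E =
        ((ell x0 (pistar x0 th))%:E + \int[P x0 (pistar x0 th) th]_y (h y th)%:E)%E)
     /\ (forall a0 : A,
          ((J th + h x0 th)%:E <= (ell x0 a0)%:E + \int[P x0 a0 th]_y (h y th)%:E)%E)) ->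
  (* (i) Lipschitz dynamics *)
  (forall x0 a0 th th', Theta th -> Theta th' ->
     (L1dist (P x0 a0 th) (P x0 a0 th') <= (C * `|th - th'|)%:E)%E) ->
  (* ---- the probabilistic model: prior, system, DS-PSRL ---- *)
  measurable_fun setT thetas ->
  (forall w, Theta (thetas w)) ->
  Pr.-integrable setT (fun w => (J (thetas w))%:E) ->
  (forall t, measurable_fun setT (x t)) ->
  (forall t, measurable_fun setT (thetat t)) ->
  (* post t is the posterior P_t: a version of the conditional law of theta_*
     given the observed history (x_1, a_1, ..., x_t) *)
  (forall t, (1 <= t)%N -> forall B, measurable B ->
     forall Y : set (\bar R), measurable Y ->
       obs_sigma x a t ((fun w => post t w B) @^-1` Y)) ->
  (forall t, (1 <= t)%N -> forall B, measurable B -> forall E,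
     obs_sigma x a t E ->
     Pr (E `&` thetas @^-1` B) = (\int[Pr]_(w in E) post t w B)%E) ->
  (* at t = L = 1, 2, 4, ... DS-PSRL samples theta~_t from P_t (fresh randomness) *)
  (forall t, (1 <= t)%N -> is_sample_time t -> forall B, measurable B -> forall E,
     before_sample_sigma thetas x thetat t E ->
     Pr (E `&` thetat t @^-1` B) = (\int[Pr]_(w in E) post t w B)%E) ->
  (* otherwise the sampled parameter is kept *)
  (forall t, (2 <= t)%N -> ~ is_sample_time t -> thetat t = thetat t.-1) ->
  (* the system: x_(t+1) ~ P(. | x_t, a_t, theta_* ) *)
  (forall t, (1 <= t)%N -> forall B, measurable B -> forall E,
     before_transition_sigma thetas x thetat t E ->
     Pr (E `&` x t.+1 @^-1` B) =
       (\int[Pr]_(w in E) P (x t w) (a t w) (thetas w) B)%E) ->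
  (* (ii) concentrating posterior *)
  (forall j, (1 <= j <= episode T)%N ->
     (\int[Pr]_w ((Nep T j.-1)%:R * (thetas w - thetat (episode_start j) w) ^+ 2)%:E
        <= (C' * ln T%:R)%:E)%E) ->
  (* conclusion: Bayes regret bound R_T = O~(C sqrt(C' T)) *)
  (\int[Pr]_w (\sum_(1 <= t < T.+1) (ell (x t w) (a t w) - J (thetas w)))%:E
     <= (K * H * (ln T%:R + C * Num.sqrt (C' * T%:R * ln T%:R)))%:E)%E.
Proof.
(* [2 / ln 2] counts episodes in units of [ln T]. In [2 * sqrt 2], the 2 comes from the sum of
   [t^(-1/2)] and the [sqrt 2] from the second moment bound [2 C' ln T / t]. *)
exists (2 / ln 2 + 2 * Num.sqrt 2) => H C C' T dO dX dA Omega X A Theta ell P J.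
move=> h pistar Pr thetas x thetat post a H0 C0 T2 mTheta mell mP mJ mh mpi hH.
move=> bellman lip mths thsT iJ mx mtht _ postE sampE keep trans conc.
have ma t : measurable_fun setT (a t).
  apply: (measurableT_comp mpi (_ : measurable_fun _ (fun w => (x t w, thetat t w)))).
  exact: measurable_fun_pair.
have lnT0 : 0 <= ln T%:R :> R by rewrite ln_ge0// ler1n ltnW.
(* At the start of an episode both laws are the mean of the posterior: take the whole space as [E]
   in [postE] and [sampE]. *)
have law t B : (0 < t)%N -> measurable B ->
    Pr (thetas @^-1` B) = Pr (thetat t @^-1` B).
  move=> t0 mB.
  rewrite (constant_on_episode _ _ _ keep t0).
  have s0 : (0 < episode_start (episode t))%N by rewrite expn_gt0.
  have sT (G : set (set Omega)) : <<s G >> setT.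
    have [s0' sD _] := smallest_sigma_algebra [set: Omega] G.
    by have := sD _ s0'; rewrite setD0.
  rewrite -[thetas @^-1` B]setTI -[thetat _ @^-1` B]setTI.
  rewrite (postE _ s0)//; last exact: sT.
  by rewrite (sampE _ s0 (is_sample_time_episode_start _))//; exact: sT.
(* Samples lie in [Theta] only almost surely, because they share the law of [thetas]. *)
have aeTheta : {ae Pr, forall w, forall t, Theta (thetat t.+1 w)}.
  apply: ae_foralln => t; exists (thetat t.+1 @^-1` (~` Theta)); split => //.
  - by rewrite -[X in measurable X]setTI; apply: mtht => //; exact: measurableC.
  - apply: etrans (esym (law t.+1 _ isT (measurableC mTheta))) _.
    by rewrite (_ : _ @^-1` _ = set0) ?measure0//; apply/seteqP; split => w //=.
(* [h] is constrained on [Theta] only; its truncation is bounded everywhere. *)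
pose hc y th := Num.max 0 (Num.min H (h y th)).
have mhc : measurable_fun setT (fun p : X * R => hc p.1 p.2).
  apply: measurable_maxr; first exact: measurable_cst.
  by apply: measurable_minr => //; exact: measurable_cst.
have hcH y th : 0 <= hc y th <= H.
  by rewrite /hc le_max lexx/= ge_max (ltW H0) ge_min lexx.
have hcE y th : Theta th -> hc y th = h y th.
  move=> /hH /(_ y) /andP[h0 h1].
  by rewrite /hc min_r// max_r.
pose k t w := P (x t w) (a t w) (thetas w).
have mk t B : measurable B -> measurable_fun setT (fun w => k t w B).
  move=> mB; apply: (measurableT_comp (mP B mB)
    (_ : measurable_fun _ (fun w => (x t w, a t w, thetas w)))).
  by apply: measurable_fun_pair => //; exact: measurable_fun_pair.
have mEhc : measurable_fun setT (fun p : X * R => (hc p.1 p.2)%:E).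
  exact/measurable_EFinP.
have Ehc0 (p : X * R) : (0 <= (hc p.1 p.2)%:E)%E.
  by rewrite lee_fin; case/andP: (hcH p.1 p.2).
have mhcs th : measurable_fun setT (fun y => hc y th).
  apply: (measurableT_comp mhc (_ : measurable_fun _ (fun y => (y, th)))).
  by apply: measurable_fun_pair => //; exact: measurable_cst.
(* The mean of the truncated [h] at the next state under the true transition law, with the sampled
   parameter frozen. *)
pose V t w := (\int[k t w]_y (hc y (thetat t w))%:E)%E.
have mV t : measurable_fun setT (V t).
  exact: (measurable_integral_pker (k t) (thetat t) _ (mk t) (mtht t) mEhc Ehc0).
have V0 t w : (0 <= V t w)%E.
  by apply: integral_ge0 => y _; exact: (Ehc0 (y, _)).
have VH t w : (V t w <= H%:E)%E.
  apply: (@le_trans _ _ (\int[k t w]_y H%:E)%E).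
    apply: ge0_le_integral => //.
    - by move=> y _; exact: (Ehc0 (y, _)).
    - exact/measurable_EFinP.
    - by move=> y _; rewrite lee_fin; case/andP: (hcH y (thetat t w)).
  by rewrite integral_cst//= probability_setT mule1.
have Vfin t w : V t w \is a fin_num.
  by rewrite ge0_fin_numE// (le_lt_trans (VH t w))// ltry.
pose c t s w := hc (x t w) (thetat s w).
have mc t s : measurable_fun setT (c t s).
  apply: (measurableT_comp mhc (_ : measurable_fun _ (fun w => (x t w, thetat s w)))).
  exact: measurable_fun_pair.
have EzV t : (0 < t)%N -> (\int[Pr]_w (c t.+1 t w)%:E = \int[Pr]_w V t w)%E.
  move=> t0.
  apply: (integral_freezing Pr (k t) (x t.+1) (thetat t)
    (fun p => (hc p.1 p.2)%:E) (mk t)) => // B1 B2 mB1 mB2.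
  apply: (trans _ t0 _ mB1); apply: sub_sigma_algebra; right.
  by exists t; split; [rewrite /= t0 leqnn|exists B2].
have bnd_int (f : Omega -> R) : measurable_fun setT f ->
    (forall w, 0 <= f w <= H) -> Pr.-integrable setT (EFin \o f).
  move=> mf fH; apply: (@le_integrable _ _ _ Pr setT _ _ (fun=> H%:E)) => //.
  - exact/measurable_EFinP.
  - move=> w _; case/andP: (fH w) => f0 f1.
    by rewrite /= lee_fin !ger0_norm// ltW.
  - exact: finite_measure_integrable_cst.
have iz t s : Pr.-integrable setT (fun w => (c t s w)%:E).
  by apply: bnd_int => // w; exact: hcH.
have iV t : Pr.-integrable setT (V t).
  rewrite (_ : V t = EFin \o (fine \o V t)); last first.
    by apply/funext => w /=; rewrite fineK.
  apply: bnd_int; first exact: measurableT_comp.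
  by move=> w; rewrite fine_ge0//= -lee_fin fineK.
pose M := C' * ln T%:R.
(* The sign of [C'] is not assumed; it is the concentration bound for the first episode that forces
   [M >= 0]. *)
have M0 : 0 <= M.
  rewrite -lee_fin; apply: le_trans (conc 1 _); last by rewrite /= /episode.
  by apply: integral_ge0 => w _; rewrite lee_fin mulr_ge0// sqr_ge0.
have M20 : 0 <= 2 * M by exact: mulr_ge0.
pose dist t w := thetas w - thetat t w.
have mdist t : measurable_fun setT (dist t) by exact: measurable_funB.
have dist2 t : (0 < t <= T)%N ->
    (\int[Pr]_w (dist t w ^+ 2)%:E <= (2 / t%:R * M)%:E)%E.
  move=> tT; have /andP[t0 tT'] := tT.
  pose N : R := (Nep T (episode t).-1)%:R.
  have mN : measurable_fun setT (fun w => (N * dist t w ^+ 2)%:E).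
    by apply/measurable_EFinP; apply: measurable_funM => //; exact: measurable_funX.
  have N0 w : (0 <= (N * dist t w ^+ 2)%:E)%E by rewrite lee_fin mulr_ge0// sqr_ge0.
  have tp : 0 < t%:R :> R by rewrite ltr0n.
  have t2 : 0 <= 2 / t%:R :> R by rewrite divr_ge0.
  apply: (@le_trans _ _ (\int[Pr]_w ((2 / t%:R)%:E * (N * dist t w ^+ 2)%:E))%E).
    apply: ge0_le_integral => //.
    - by move=> w _; rewrite lee_fin sqr_ge0.
    - by apply/measurable_EFinP; exact: measurable_funX.
    - exact: measurable_funeM.
    - move=> w _; rewrite -EFinM lee_fin mulrA ler_peMl ?sqr_ge0//.
      rewrite mulrAC ler_pdivlMr// mul1r /N -natrM ler_nat mul2n ltnW//.
      exact: ltn_double_Nep.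
  rewrite ge0_integralZl//= [leRHS]EFinM lee_wpmul2l//.
  rewrite /N /dist (constant_on_episode _ _ _ keep t0).
  by apply: conc; exact: leq_trunc_log.
(* The first two brackets integrate to zero; only the model error survives in expectation. *)
pose D t w := (J (thetat t w) - J (thetas w)) + (c t.+1 t w - fine (V t w)) +
  H * C * `|dist t w|.
have intD t : (0 < t <= T)%N -> Pr.-integrable setT (fun w => (D t w)%:E) /\
    (\int[Pr]_w (D t w)%:E <=
       (H * C * (Num.sqrt (2 * M) * (Num.sqrt t%:R)^-1))%:E)%E.
  move=> tT; have /andP[t0 tT'] := tT.
  have [iJt EJ] := integral_eq_distribution Pr _ _ _ mths (mtht t) mJ
    (fun B mB => law t B t0 mB) iJ.
  have [id Ed] := abs_le_sqrt_second_moment Pr _ _ (mdist t) (dist2 t tT).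
  pose f1 w := ((J (thetat t w))%:E - (J (thetas w))%:E)%E.
  pose f2 w := ((c t.+1 t w)%:E - V t w)%E.
  pose f3 w := ((H * C)%:E * `|dist t w|%:E)%E.
  have DE : (fun w => (D t w)%:E) = (fun w => f1 w + f2 w + f3 w)%E.
    by apply/funext => w; rewrite /D !EFinD !EFinN (EFinM (H * C)) fineK.
  have i1 : Pr.-integrable setT f1 by exact: integrableB.
  have i2 : Pr.-integrable setT f2 by exact: integrableB.
  have i12 : Pr.-integrable setT (fun w => f1 w + f2 w)%E by exact: integrableD.
  have i3 : Pr.-integrable setT f3 by exact: integrableZl.
  rewrite DE; split; first exact: integrableD.
  have E1 : (\int[Pr]_w f1 w = 0)%E.
    by rewrite integralB// -EJ subee// (integrable_fin_num measurableT iJ).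
  have E2 : (\int[Pr]_w f2 w = 0)%E.
    by rewrite integralB// EzV// subee// (integrable_fin_num measurableT (iV t)).
  rewrite (integralD measurableT i12 i3) (integralD measurableT i1 i2).
  rewrite E1 E2 !add0e integralZl// [leRHS]EFinM.
  rewrite lee_wpmul2l ?lee_fin ?mulr_ge0 ?(ltW H0)//.
  apply: (le_trans Ed); rewrite lee_fin -sqrtrV ?ler0n// -sqrtrM//.
  by rewrite mulrAC.
pose G w := H * (episode T)%:R + \sum_(1 <= t < T.+1) D t w.
have FG : {ae Pr, forall w,
    ((\sum_(1 <= t < T.+1) (ell (x t w) (a t w) - J (thetas w)))%:E <= (G w)%:E)%E}.
  apply: filterS aeTheta => w ThetaT; rewrite lee_fin /G.
  have step : forall t, (0 < t)%N -> ell (x t w) (a t w) - J (thetas w) <=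
      D t w + (c t t w - c t.+1 t w).
    move=> [//|t] _; have Tht := ThetaT t.
    have [+ _] := bellman _ Tht (x t.+1 w).
    rewrite -/(a t.+1 w) -(hcE _ _ Tht).
    under eq_integral do rewrite -(hcE _ _ Tht).
    have := le_integral_L1dist _ _ _ _ _ (mhcs (thetat t.+1 w)) (hcH^~ _)
      (lip (x t.+1 w) (a t.+1 w) _ _ (thsT w) Tht).
    rewrite -/(V t.+1 w) -(fineK (Vfin _ _)).
    (* The Bellman equation has a finite left side, which excludes infinite values of the integral
       under the sampled model. *)
    case: (\int[_]_y _)%E => [q||] //=; rewrite -!EFinD lee_fin => Vq [Jq].
    rewrite /D /dist /c; lra.
  have T1 : T.-1.+1 = T by rewrite prednK// ltnW.
  have tele : \sum_(1 <= t < T.+1) (c t t w - c t.+1 t w) <= H * (episode T)%:R.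
    have := episodewise_telescope H (fun t s => c t s w) T.-1
      (fun t s => hcH _ _).
    rewrite T1 => /(_ _)/le_trans; apply.
      by move=> t t2 nt; rewrite /c (keep t t2 nt).
    by rewrite gerBl; case/andP: (hcH (x T.+1 w) (thetat T w)).
  rewrite addrC; apply: le_trans (lerD (lexx _) tele); rewrite -big_split/=.
  by rewrite big_nat [leRHS]big_nat; apply: ler_sum => t /andP[t1 _]; exact: step.
have iD (i : 'I_T) : Pr.-integrable setT (fun w => (D i.+1 w)%:E).
  by have [] := intD i.+1 (ltn_ord i).
have GE w : (G w)%:E =
    ((H * (episode T)%:R)%:E + \sum_(i < T) (D i.+1 w)%:E)%E.
  by rewrite EFinD sumEFin big_add1 big_mkord.
have iS : Pr.-integrable setT (fun w => \sum_(i < T) (D i.+1 w)%:E)%E.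
  exact: integrable_sum.
have icst : Pr.-integrable setT (fun=> (H * (episode T)%:R)%:E).
  exact: finite_measure_integrable_cst.
apply: (@le_trans _ _ (\int[Pr]_w (G w)%:E)%E).
  apply: ae_le_integral => //.
  - apply/measurable_EFinP; apply: measurable_sum => t.
    apply: measurable_funB; last exact: measurableT_comp.
    apply: (measurableT_comp mell (_ : measurable_fun _ (fun w => (x t w, a t w)))).
    exact: measurable_fun_pair.
  - under eq_fun do rewrite GE.
    exact: measurable_int (integrableD measurableT icst iS).
under eq_integral do rewrite GE.
rewrite (integralD measurableT icst iS) integral_sum//.
rewrite integral_cst//= probability_setT mule1.
apply: (@le_trans _ _ ((H * (episode T)%:R)%:E + \sum_(i < T)
   (H * C * (Num.sqrt (2 * M) * (Num.sqrt i.+1%:R)^-1))%:E)%E).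
  by rewrite leeD2l//; apply: lee_sum => i _; have [] := intD i.+1 (ltn_ord i).
rewrite sumEFin -EFinD lee_fin -mulr_sumr -mulr_sumr.
have := @sum_invsqrt_le R T; rewrite big_add1 big_mkord.
move=> /(ler_wpM2l (mulr_ge0 (mulr_ge0 (ltW H0) C0) (sqrtr_ge0 (2 * M)))).
have := ler_wpM2l (ltW H0) (@episode_le_ln R T T2).
have -> : C' * T%:R * ln T%:R = M * T%:R by rewrite /M mulrAC.
rewrite (sqrtrM M (ler0n R 2)) (sqrtrM T%:R M0) => S1 S2.
(* Since one [K] multiplies both terms of the bound, two cross products appear on the right; they
   are nonnegative. *)
have := mulr_ge0 (mulr_ge0 (ltW H0) (sqrtr_ge0 (2 : R))) lnT0.
have l2 : 0 <= 2 / ln 2 :> R by rewrite divr_ge0// ln_ge0// ler1n.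
have := mulr_ge0 (mulr_ge0 (mulr_ge0 (mulr_ge0 (ltW H0) C0) l2) (sqrtr_ge0 M))
  (sqrtr_ge0 (T%:R : R)).
lra.
Qed.
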